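(* Let $K\subset\mathbb{R}^3$ be a finite union $K=D_1\cup\cdots\cup D_k$ where each $D_i$ is a simplicial $2$-complex. Then there exist $N\in\mathbb{N}$ and a bi-Lipschitz embedding of $(K,d_{\mathbb{H}})$ into $\mathbb{R}^N$.
   Context: A $0$-simplex is a point of $\mathbb{R}^3$, a $1$-simplex is the convex hull of two distinct points, a $2$-simplex is the convex hull of three non-collinear points. A (compact) simplicial $2$-complex $K\subset\mathbb{R}^3$ is a finite union $S_1\cup\dots\cup S_n$ where each $S_i$ is a $k_i$-simplex, $k_i\in\{0,1,2\}$, and for all $i,j$ either $S_i\cap S_j=\emptyset$, or $S_i\cap S_j$ is a common edge of $S_i$ and $S_j$, or $S_i=S_j$. For $w=(x,y,z)$, $w'=(x',y',z')$, $d_{\mathbb{H}}(w,w')=|x-x'|+|y-y'|+|z-z'+\tfrac12(xy'-x'y)|^{1/2}$. A map $f$ from $(A,d_{\mathbb{H}})$ to $\mathbb{R}^N$ is a bi-Lipschitz embedding if $L^{-1}d_{\mathbb{H}}(a,b)\le|f(a)-f(b)|\le Ld_{\mathbb{H}}(a,b)$ for all $a,b\in A$ and some $L\ge1$. *)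

(* Defs.v *)
From Stdlib Require Import Reals List.
Import ListNotations.
Open Scope R_scope.

Record pt := mkpt { px : R; py : R; pz : R }.

(* Linear combination  sum_i lam_i * v_i  (extra entries ignored; lengths
   are forced equal in [hull]). *)
Fixpoint lincomb (lam : list R) (vs : list pt) : pt :=
  match lam, vs with
  | l :: lam', v :: vs' =>
      let r := lincomb lam' vs' in
      mkpt (l * px v + px r) (l * py v + py r) (l * pz v + pz r)
  | _, _ => mkpt 0 0 0
  end.

Fixpoint sumR (l : list R) : R :=
  match l with [] => 0 | a :: l' => a + sumR l' end.

Definition hull (vs : list pt) (x : pt) : Prop :=
  exists lam : list R,
    length lam = length vs /\ Forall (fun t => 0 <= t) lam /\
    sumR lam = 1 /\ x = lincomb lam vs.

(* Non-collinearity of three points: (b-a) x (c-a) <> 0. *)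
Definition noncollinear (a b c : pt) : Prop :=
  let ux := px b - px a in let uy := py b - py a in let uz := pz b - pz a in
  let vx := px c - px a in let vy := py c - py a in let vz := pz c - pz a in
  ~ (uy * vz - uz * vy = 0 /\ uz * vx - ux * vz = 0 /\ ux * vy - uy * vx = 0).

(* A k-simplex (k in {0,1,2}) given by its vertex list; the simplex itself
   is the set [hull vs]. *)
Definition is_simplex (vs : list pt) : Prop :=
  match vs with
  | [a] => True
  | [a; b] => a <> b
  | [a; b; c] => noncollinear a b c
  | _ => False
  end.

Definition set_eq (A B : pt -> Prop) : Prop := forall x, A x <-> B x.

Definition is_face (F : pt -> Prop) (vs : list pt) : Prop :=
  exists ws, ws <> [] /\ incl ws vs /\ set_eq F (hull ws).

Definition is_complex (D : list (list pt)) : Prop :=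
  Forall is_simplex D /\
  forall S T, In S D -> In T D ->
    (forall x, ~ (hull S x /\ hull T x)) \/
    (exists F, is_face F S /\ is_face F T /\
               set_eq (fun x => hull S x /\ hull T x) F) \/
    set_eq (hull S) (hull T).

Definition union_set (Ds : list (list (list pt))) (x : pt) : Prop :=
  exists D, In D Ds /\ exists S, In S D /\ hull S x.

Definition dH (w w' : pt) : R :=
  Rabs (px w - px w') + Rabs (py w - py w') +
  sqrt (Rabs (pz w - pz w' + / 2 * (px w * py w' - px w' * py w))).

(* Euclidean distance in R^N, vectors encoded as nat -> R (coords 0..N-1). *)
Fixpoint sumsq (N : nat) (u v : nat -> R) : R :=
  match N with
  | O => 0
  | S n => sumsq n u v + (u n - v n) ^ 2
  end.

Definition euclid (N : nat) (u v : nat -> R) : R := sqrt (sumsq N u v).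

(* Main.v *)
(* On each plane the Heisenberg metric embeds. On a vertical plane it is the product of a
   line and a snowflaked line [|s - t|^(1/2)], and lacunary trigonometric series embed the
   latter. A non-vertical plane is a left translate of [z = 0], on which the metric is
   comparable to [|r - r'| + min r r' * |u - u'|^(1/2)] in polar coordinates [w = r u], so
   [r] together with [r h(u)], [h] a snowflake embedding of the unit circle, embeds it.
   Every simplex lies in a plane, and embeddability passes to finite unions: coordinates
   extend to Lipschitz functions (McShane), and adding the distance to [A] to the extended
   coordinates for [A] and for [B] gives an embedding of the union of [A] and [B]. *)
From Coquelicot Require Import Coquelicot.
Require Import Defs.
From Stdlib Require Import Reals List Lra Lia Psatz Classical.
Open Scope R_scope.

(** * Lipschitz extension, embeddability and finite unions *)

Record pseudometric {X : Type} (d : X -> X -> R) : Prop := {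
  pseudo_refl : forall a, d a a = 0;
  pseudo_sym : forall a b, d a b = d b a;
  pseudo_tri : forall a b c, d a c <= d a b + d b c }.

Lemma pseudo_nonneg {X : Type} (d : X -> X -> R) :
  pseudometric d -> forall a b, 0 <= d a b.
Proof.
  intros Hd a b.
  pose proof (pseudo_tri d Hd a b a). rewrite (pseudo_refl d Hd), (pseudo_sym d Hd b a) in H. lra.
Qed.

Definition lipschitz_on {X : Type} (d : X -> X -> R) (A : X -> Prop) (L : R) (f : X -> R) :=
  forall a b, A a -> A b -> Rabs (f a - f b) <= L * d a b.

Definition lipschitz {X : Type} (d : X -> X -> R) := lipschitz_on d (fun _ => True).

(* For [f = 0] and [L = 1] the last clause says that [F] is minus the distance to [A]. *)
Lemma mcshane_extension {X : Type} (d : X -> X -> R) (A : X -> Prop) (L : R) (f : X -> R) :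
  pseudometric d -> 0 <= L -> (exists a, A a) -> lipschitz_on d A L f ->
  exists F, lipschitz d L F /\ (forall a, A a -> F a = f a) /\
    forall x eps, 0 < eps -> exists a, A a /\ F x - eps < f a - L * d x a.
Proof.
  intros Hd HL [a0 Ha0] Hf.
  (* The extension is the supremum over [A] of the downward cones [f a - L * d x a]. *)
  set (E := fun x y => exists a, A a /\ y = f a - L * d x a).
  assert (Hsup : forall x, { y | is_lub (E x) y }).
  { intros x. apply completeness.
    - exists (f a0 + L * d x a0). intros y [a [Ha ->]].
      specialize (Hf a a0 Ha Ha0). apply Rabs_le_between in Hf.
      pose proof (pseudo_tri d Hd a x a0). rewrite (pseudo_sym d Hd a x) in H. nra.
    - exists (f a0 - L * d x a0), a0. auto. }
  exists (fun x => proj1_sig (Hsup x)).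
  assert (Hub : forall x a, A a -> f a - L * d x a <= proj1_sig (Hsup x)).
  { intros x a Ha. apply (proj2_sig (Hsup x)). exists a. auto. }
  assert (Hlub : forall x y, is_upper_bound (E x) y -> proj1_sig (Hsup x) <= y).
  { intros x y. apply (proj2_sig (Hsup x)). }
  assert (Hle : forall x x', proj1_sig (Hsup x) <= proj1_sig (Hsup x') + L * d x x').
  { intros x x'. apply Hlub. intros z [a [Ha ->]]. pose proof (Hub x' a Ha).
    pose proof (pseudo_tri d Hd x' x a). rewrite (pseudo_sym d Hd x' x) in H0. nra. }
  split; [|split].
  - intros x x' _ _. apply Rabs_le_between.
    pose proof (Hle x x'). pose proof (Hle x' x). rewrite (pseudo_sym d Hd x' x) in H0. lra.
  - intros a Ha. apply Rle_antisym.
    + apply Hlub. intros z [b [Hb ->]].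
      specialize (Hf a b Ha Hb). apply Rabs_le_between in Hf. lra.
    + pose proof (Hub a a Ha). rewrite (pseudo_refl d Hd) in H. lra.
  - intros x eps Heps. apply NNPP. intros Hn.
    assert (proj1_sig (Hsup x) <= proj1_sig (Hsup x) - eps); [|lra].
    apply Hlub. intros z [a [Ha ->]]. apply Rnot_lt_le. intros Hlt. apply Hn. exists a. auto.
Qed.

(** A bi-Lipschitz embedding of [A] into some [R^N] with the maximum norm, its coordinates listed in
    [fs]. They are Lipschitz on all of [X], so that coordinates made for different sets can be put
    into one list. *)
Definition embeddable {X : Type} (d : X -> X -> R) (A : X -> Prop) : Prop :=
  exists fs c, 0 < c /\
    (forall f, In f fs -> exists L, lipschitz d L f) /\
    forall a b, A a -> A b -> exists f, In f fs /\ c * d a b <= Rabs (f a - f b).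

Lemma lipschitz_common_constant {X : Type} (d : X -> X -> R) (fs : list (X -> R)) :
  pseudometric d -> (forall f, In f fs -> exists L, lipschitz d L f) ->
  exists L, 0 <= L /\ forall f, In f fs -> lipschitz d L f.
Proof.
  intros Hd. induction fs as [|g fs IH]; intros H.
  - exists 0. split; [lra|]. intros f [].
  - destruct IH as [L [HL HL']]. { intros f Hf. apply H. now right. }
    destruct (H g (or_introl eq_refl)) as [L' HL''].
    exists (Rmax L L'). pose proof (Rmax_l L L'). pose proof (Rmax_r L L').
    split; [lra|]. intros f Hf a b Ta Tb. pose proof (pseudo_nonneg d Hd a b).
    destruct Hf as [<-|Hf].
    + specialize (HL'' a b Ta Tb). nra.
    + specialize (HL' f Hf a b Ta Tb). nra.
Qed.

Lemma embeddable_subset {X : Type} (d : X -> X -> R) (A B : X -> Prop) :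
  (forall x, A x -> B x) -> embeddable d B -> embeddable d A.
Proof.
  intros HAB (fs & c & Hc & Hl & Hs). exists fs, c. auto.
Qed.

(** McShane extensions agree with the given functions on [A], so separation there survives. Empty
    [A] is treated apart, since the extension is a supremum over [A]. *)
Lemma embeddable_of_lipschitz_on {X : Type} (d : X -> X -> R) (A : X -> Prop)
    (fs : list (X -> R)) (c : R) :
  pseudometric d -> 0 < c ->
  (forall f, In f fs -> exists L, 0 <= L /\ lipschitz_on d A L f) ->
  (forall a b, A a -> A b -> exists f, In f fs /\ c * d a b <= Rabs (f a - f b)) ->
  embeddable d A.
Proof.
  intros Hd Hc Hl Hs.
  destruct (classic (exists a, A a)) as [Hne|He].
  2:{ exists nil, 1. split; [lra|]. split; [intros f []|].
      intros a b Ha. destruct He. eauto. }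
  assert (H : exists gs, (forall g, In g gs -> exists L, lipschitz d L g) /\
      forall f, In f fs -> exists g, In g gs /\ forall a, A a -> g a = f a).
  { clear Hs. induction fs as [|f fs IH].
    - exists nil. split; intros ? [].
    - destruct IH as [gs [H1 H2]]. { intros f' Hf'. apply Hl. now right. }
      destruct (Hl f (or_introl eq_refl)) as (L & HL & Hf).
      destruct (mcshane_extension d A L f Hd HL Hne Hf) as (g & Hg & Hga & _).
      exists (g :: gs). split.
      + intros g' [<-|Hg']; eauto.
      + intros f' [<-|Hf'].
        * exists g. split; [now left|auto].
        * destruct (H2 f' Hf') as (g' & ? & ?). exists g'. split; [now right|auto]. }
  destruct H as (gs & H1 & H2). exists gs, c. split; [auto|]. split; [auto|].
  intros a b Ha Hb. destruct (Hs a b Ha Hb) as (f & Hf & Hfc).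
  destruct (H2 f Hf) as (g & Hg & Hgf). exists g. split; [auto|].
  rewrite (Hgf a Ha), (Hgf b Hb). auto.
Qed.

(* The distance to [A] separates [a] in [A] from [b] in [B] unless [b] is much closer
   to some [a'] in [A] than to [a]; then a function separating [a] from [a'] separates
   [a] from [b]. *)
Lemma embeddable_union {X : Type} (d : X -> X -> R) (A B : X -> Prop) :
  pseudometric d -> embeddable d A -> embeddable d B ->
  embeddable d (fun x => A x \/ B x).
Proof.
  intros Hd HA HB.
  destruct (classic (exists a, A a)) as [Hne|He].
  2:{ apply embeddable_subset with B; [|auto]. intros x [Hx|Hx]; [|auto].
      destruct He. eauto. }
  destruct HA as (fs & c & Hc & Hfl & Hfs). destruct HB as (gs & c' & Hc' & Hgl & Hgs).
  destruct (lipschitz_common_constant d fs Hd Hfl) as (L & HL & HfL).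
  destruct (mcshane_extension d A 1 (fun _ => 0) Hd) as (D & HD & HDA & HDe);
    [lra|auto| |].
  { intros a b _ _. rewrite Rminus_diag, Rabs_R0. pose proof (pseudo_nonneg d Hd a b). lra. }
  (* Replacing [b] by a point [a'] with [d b a' < eps * d a b] costs at most
     [eps * (c + L) * d a b], and this [eps] makes the cost half of [c * d a b]. *)
  set (eps := c / (2 * (c + L))).
  assert (Heps : 0 < eps) by (apply Rdiv_lt_0_compat; lra).
  assert (Heps' : eps * (c + L) = c / 2) by (unfold eps; field; lra).
  assert (Hcross : forall a b, A a -> exists f, In f (D :: fs ++ gs) /\
      Rmin eps (c / 2) * d a b <= Rabs (f a - f b)).
  { intros a b Ha. pose proof (pseudo_nonneg d Hd a b) as Hab.
    pose proof (Rmin_l eps (c / 2)). pose proof (Rmin_r eps (c / 2)).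
    destruct (Rle_lt_dec (eps * d a b) (- D b)) as [Hfar|Hnear].
    - exists D. split; [now left|]. rewrite (HDA a Ha).
      rewrite Rabs_pos_eq by nra. nra.
    (* This tolerance cancels [D b] and leaves [d b a' < eps * d a b]; it is positive because [b] is
       near [A]. *)
    - destruct (HDe b (eps * d a b + D b)) as (a' & Ha' & Hba'); [lra|].
      destruct (Hfs a a' Ha Ha') as (f & Hf & Hfa).
      exists f. split; [right; apply in_or_app; now left|].
      pose proof (HfL f Hf a' b I I) as Hfb.
      rewrite (pseudo_sym d Hd a' b) in Hfb.
      pose proof (pseudo_tri d Hd a a' b). rewrite (pseudo_sym d Hd a' b) in H1.
      pose proof (Rabs_triang (f a - f b) (f b - f a')).
      replace (f a - f b + (f b - f a')) with (f a - f a') in H2 by ring.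
      rewrite (Rabs_minus_sym (f b)) in H2.
      assert (L * d b a' <= L * (eps * d a b)) by nra.
      assert (c * (d a b - eps * d a b) <= c * d a a') by nra.
      assert (c / 2 * d a b = c * d a b - eps * (c + L) * d a b) by nra.
      nra. }
  exists (D :: fs ++ gs), (Rmin (Rmin eps (c / 2)) (Rmin c c')).
  pose proof (Rmin_l (Rmin eps (c / 2)) (Rmin c c')).
  pose proof (Rmin_r (Rmin eps (c / 2)) (Rmin c c')).
  pose proof (Rmin_l c c'). pose proof (Rmin_r c c').
  split. { repeat apply Rmin_pos; lra. }
  split.
  { intros f [<-|Hf]; [now exists 1|]. apply in_app_or in Hf. destruct Hf; auto. }
  intros a b Ha Hb. pose proof (pseudo_nonneg d Hd a b) as Hab.
  destruct Ha as [Ha|Ha]; [|destruct Hb as [Hb|Hb]].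
  - destruct (Hcross a b Ha) as (f & Hf & Hfc). exists f. split; [auto|nra].
  - destruct (Hcross b a Hb) as (f & Hf & Hfc). exists f. split; [auto|].
    rewrite Rabs_minus_sym. rewrite (pseudo_sym d Hd b a) in Hfc. nra.
  - destruct (Hgs a b Ha Hb) as (f & Hf & Hfc). exists f.
    split; [right; apply in_or_app; now right|nra].
Qed.

(** * Lacunary series and the snowflaked line *)

Lemma cos_lipschitz (s t : R) : Rabs (cos s - cos t) <= Rabs (s - t).
Proof.
  destruct (MVT_gen cos t s (fun x => - sin x)) as (c & _ & ->).
  - intros x _. auto_derive; [auto|ring].
  - intros x _. apply continuity_cos.
  - rewrite Rabs_mult, Rabs_Ropp. pose proof (SIN_bound c).
    assert (Rabs (sin c) <= 1) by (apply Rabs_le; lra). pose proof (Rabs_pos (s - t)). nra.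
Qed.

Lemma sin_lipschitz (s t : R) : Rabs (sin s - sin t) <= Rabs (s - t).
Proof.
  destruct (MVT_gen sin t s cos) as (c & _ & ->).
  - intros x _. auto_derive; [auto|ring].
  - intros x _. apply continuity_sin.
  - rewrite Rabs_mult. pose proof (COS_bound c).
    assert (Rabs (cos c) <= 1) by (apply Rabs_le; lra). pose proof (Rabs_pos (s - t)). nra.
Qed.

(** The squared chord on the unit circle is [2 - 2 * cos (s - t)], at least [1/5], whereas two
    differences below [3/10] would give less than [18/100]. *)
Lemma cos_sin_separate (s t : R) : / 2 <= Rabs (s - t) <= 1 ->
  3 / 10 <= Rabs (cos s - cos t) \/ 3 / 10 <= Rabs (sin s - sin t).
Proof.
  intros H.
  assert (Hc : cos (s - t) <= 9 / 10).
  { set (u := Rabs (s - t) / 2).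
    replace (cos (s - t)) with (1 - 2 * sin u * sin u).
    2:{ rewrite <- cos_2a_sin. unfold u.
        replace (2 * (Rabs (s - t) / 2)) with (Rabs (s - t)) by field.
        unfold Rabs. destruct Rcase_abs; [apply cos_neg|auto]. }
    assert (Hu : / 4 <= u <= / 2) by (unfold u; lra).
    (* The Taylor bound [u - u^3 / 6 <= sin u] with [u >= 1/4] makes [2 * sin u * sin u] at least
       [1/10]. *)
    destruct (pre_sin_bound u 0) as [Hs _]; [lra|lra|].
    unfold sin_approx, sin_term in Hs. simpl in Hs.
    assert (Hq : u * u * u <= u * / 4) by nra.
    assert (u - u * u * u / 6 <= sin u) by lra. nra. }
  destruct (Rle_lt_dec (3 / 10) (Rabs (cos s - cos t))) as [|H1]; [now left|].
  destruct (Rle_lt_dec (3 / 10) (Rabs (sin s - sin t))) as [|H2]; [now right|].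
  exfalso. rewrite cos_minus in Hc.
  apply Rabs_def2 in H1. apply Rabs_def2 in H2.
  pose proof (sin2_cos2 s). pose proof (sin2_cos2 t). unfold Rsqr in *.
  assert ((cos s - cos t)^2 < (3/10)^2) by nra.
  assert ((sin s - sin t)^2 < (3/10)^2) by nra.
  nra.
Qed.

(** A Weierstrass-type series. Amplitude ratio [1/32] against frequency ratio [1024 = 32^2] gives
    Hölder exponent 1/2, and the wide gap lets one term dominate the others at its own scale. The
    factor [lam] tunes the phase. *)
Definition lacunary (phi : R -> R) (lam t : R) : R :=
  Series (fun k => (/ 32) ^ k * phi (lam * 1024 ^ k * t)).

Lemma geometric_dominated (e : nat -> R) (C : R) :
  (forall k, Rabs (e k) <= C * (/ 32) ^ k) ->
  ex_series e /\ Rabs (Series e) <= C * (32 / 31).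
Proof.
  intros H.
  assert (Hq : Rabs (/ 32) < 1) by (rewrite Rabs_pos_eq; lra).
  assert (Hg : ex_series (fun k => C * (/ 32) ^ k)).
  { apply (@ex_series_scal R_AbsRing R_NormedModule C). now apply ex_series_geom. }
  assert (Ha : ex_series (fun k => Rabs (e k))).
  { apply (@ex_series_le R_AbsRing R_CompleteNormedModule _ (fun k => C * (/ 32) ^ k)); [|auto].
    intros k. unfold norm; simpl. unfold abs; simpl. rewrite Rabs_Rabsolu. auto. }
  split; [now apply ex_series_Rabs|].
  eapply Rle_trans; [now apply Series_Rabs|].
  eapply Rle_trans; [apply Series_le with (b := fun k => C * (/ 32) ^ k); [|auto]|].
  - intros k. split; [apply Rabs_pos|auto].
  - rewrite Series_scal_l, Series_geom by auto. lra.
Qed.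

(** The difference is the sum of the first [n] terms, and the sum of [32^k] over [k < n] is at most
    [32^n / 31]. *)
Lemma series_head_bound (e : nat -> R) (C : R) (n : nat) :
  ex_series e -> (forall k, (k < n)%nat -> Rabs (e k) <= C * 32 ^ k) -> 0 <= C ->
  Rabs (Series e - Series (fun k => e (n + k)%nat)) <= C * 32 ^ n / 31.
Proof.
  intros He H HC. induction n as [|n IH].
  - simpl. rewrite Rminus_diag, Rabs_R0. lra.
  - assert (Hn : ex_series (fun k => e (n + k)%nat)).
    { now apply (@ex_series_incr_n R_AbsRing R_NormedModule). }
    pose proof (Series_incr_1 _ Hn) as E. cbv beta in E.
    replace (Series (fun k => e (S n + k)%nat))
      with (Series (fun k => e (n + k)%nat) - e n).
    2:{ rewrite E, Nat.add_0_r.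
        rewrite (Series_ext (fun k => e (n + S k)%nat) (fun k => e (S n + k)%nat)); [ring|].
        intros k. f_equal. lia. }
    specialize (IH (fun k Hk => H k (Nat.lt_lt_succ_r _ _ Hk))).
    pose proof (H n (Nat.lt_succ_diag_r n)).
    apply Rabs_le_between in IH. apply Rabs_le_between in H0.
    apply Rabs_le_between. simpl. lra.
Qed.

Lemma dyadic_scale (x : R) : 0 < x <= 1 ->
  exists n, (/ 1024) ^ S n < x <= (/ 1024) ^ n.
Proof.
  intros Hx.
  destruct (pow_lt_1_zero (/ 1024)) with (y := x) as [N HN];
    [rewrite Rabs_pos_eq; lra|lra|].
  assert (HN' : (/ 1024) ^ N < x).
  { specialize (HN N (Nat.le_refl N)). apply Rabs_def2 in HN. lra. }
  clear HN. induction N as [|N IH]; [simpl in HN'; lra|].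
  destruct (Rle_lt_dec x ((/ 1024) ^ N)); [now exists N|auto].
Qed.

Section Lacunary.
Variable phi : R -> R.
Hypothesis phi_bounded : forall t, Rabs (phi t) <= 1.
Hypothesis phi_lipschitz : forall s t, Rabs (phi s - phi t) <= Rabs (s - t).
Variable lam : R.
Hypothesis lam_nonneg : 0 <= lam.

Let term t k := (/ 32) ^ k * phi (lam * 1024 ^ k * t).
Let diff s t k := term s k - term t k.

Lemma lacunary_term_bound t k : Rabs (term t k) <= 1 * (/ 32) ^ k.
Proof.
  unfold term. assert (0 < (/ 32) ^ k) by (apply pow_lt; lra).
  rewrite Rabs_mult, (Rabs_pos_eq ((/ 32) ^ k)) by lra.
  pose proof (phi_bounded (lam * 1024 ^ k * t)). nra.
Qed.

Lemma lacunary_bounded t : Rabs (lacunary phi lam t) <= 2.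
Proof.
  destruct (geometric_dominated (term t) 1 (lacunary_term_bound t)) as [_ H].
  unfold term in H. unfold lacunary. lra.
Qed.

Lemma lacunary_diff s t :
  ex_series (diff s t) /\ lacunary phi lam s - lacunary phi lam t = Series (diff s t).
Proof.
  destruct (geometric_dominated _ _ (lacunary_term_bound s)) as [Hs _].
  destruct (geometric_dominated _ _ (lacunary_term_bound t)) as [Ht _].
  split; [apply (@ex_series_minus R_AbsRing R_NormedModule _ _ Hs Ht)|].
  symmetry. apply (Series_minus _ _ Hs Ht).
Qed.

Lemma lacunary_diff_tail s t n :
  Rabs (Series (fun k => diff s t (n + k)%nat)) <= 3 * (/ 32) ^ n.
Proof.
  destruct (geometric_dominated (fun k => diff s t (n + k)%nat) (2 * (/ 32) ^ n)) as [_ H].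
  - intros k. rewrite Rmult_assoc, <- pow_add. unfold diff.
    pose proof (lacunary_term_bound s (n + k)) as H1. apply Rabs_le_between in H1.
    pose proof (lacunary_term_bound t (n + k)) as H2. apply Rabs_le_between in H2.
    apply Rabs_le. lra.
  - assert (0 < (/ 32) ^ n) by (apply pow_lt; lra). lra.
Qed.

Lemma lacunary_diff_lipschitz s t k :
  Rabs (diff s t k) <= lam * Rabs (s - t) * 32 ^ k.
Proof.
  unfold diff, term. rewrite <- Rmult_minus_distr_l, Rabs_mult.
  assert (0 < (/ 32) ^ k) by (apply pow_lt; lra).
  rewrite Rabs_pos_eq by lra.
  pose proof (phi_lipschitz (lam * 1024 ^ k * s) (lam * 1024 ^ k * t)) as H1.
  rewrite <- Rmult_minus_distr_l, Rabs_mult in H1.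
  assert (0 < 1024 ^ k) by (apply pow_lt; lra).
  rewrite (Rabs_pos_eq (lam * 1024 ^ k)) in H1 by nra.
  assert (E : (/ 32) ^ k * 1024 ^ k = 32 ^ k).
  { rewrite <- Rpow_mult_distr. f_equal. lra. }
  rewrite <- E.
  replace (lam * Rabs (s - t) * ((/ 32) ^ k * 1024 ^ k))
    with ((/ 32) ^ k * (lam * 1024 ^ k * Rabs (s - t))) by ring.
  apply Rmult_le_compat_l; lra.
Qed.

Lemma lacunary_diff_head s t n : Rabs (s - t) <= (/ 1024) ^ n ->
  Rabs (Series (diff s t) - Series (fun k => diff s t (n + k)%nat))
    <= lam * Rabs (s - t) * 32 ^ n / 31.
Proof.
  intros H. apply series_head_bound.
  - apply lacunary_diff.
  - intros k _. apply lacunary_diff_lipschitz.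
  - pose proof (Rabs_pos (s - t)). nra.
Qed.

(** For [|s - t|] between [1024^-(n+1)] and [1024^-n], the terms before [n] add up to at most
    [lam * 32^-n] by their Lipschitz bounds and the others to at most [3 * 32^-n] by size, while
    [32^-n <= 32 * sqrt |s - t|]. For [|s - t| > 1] boundedness is enough. *)
Lemma lacunary_holder s t :
  Rabs (lacunary phi lam s - lacunary phi lam t) <= 32 * (lam + 3) * sqrt (Rabs (s - t)).
Proof.
  pose proof (Rabs_pos (s - t)) as Hp.
  destruct (Req_dec (Rabs (s - t)) 0) as [H0|H0].
  { rewrite H0, sqrt_0. apply Rabs_eq_0 in H0. replace t with s by lra.
    rewrite Rminus_diag, Rabs_R0. lra. }
  destruct (Rle_lt_dec (Rabs (s - t)) 1) as [H1|H1].
  - destruct (dyadic_scale (Rabs (s - t))) as (n & Hn1 & Hn2); [lra|].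
    destruct (lacunary_diff s t) as [_ ->].
    pose proof (lacunary_diff_head s t n Hn2) as A1.
    pose proof (lacunary_diff_tail s t n) as A2.
    assert (E : lam * Rabs (s - t) * 32 ^ n <= lam * (/ 32) ^ n).
    { replace ((/ 32) ^ n) with ((/ 1024) ^ n * 32 ^ n).
      2:{ rewrite <- Rpow_mult_distr. f_equal. lra. }
      assert (0 < 32 ^ n) by (apply pow_lt; lra).
      rewrite Rmult_assoc. apply Rmult_le_compat_l; [lra|]. nra. }
    assert (Hq : (/ 32) ^ n <= 32 * sqrt (Rabs (s - t))).
    { assert ((/ 32) ^ S n <= sqrt (Rabs (s - t))); [|simpl in *; lra].
      rewrite <- (sqrt_pow2 ((/ 32) ^ S n)) by (apply pow_le; lra).
      apply sqrt_le_1_alt. rewrite <- pow_mult, Nat.mul_comm, pow_mult.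
      replace ((/ 32) ^ 2) with (/ 1024) by lra. lra. }
    assert (0 < (/ 32) ^ n) by (apply pow_lt; lra).
    apply Rabs_le_between in A1. apply Rabs_le_between in A2.
    assert (lam * (/ 32) ^ n <= lam * (32 * sqrt (Rabs (s - t)))) by nra.
    apply Rabs_le. assert (0 <= lam * (/ 32) ^ n) by nra. lra.
  - pose proof (lacunary_bounded s) as A1. pose proof (lacunary_bounded t) as A2.
    apply Rabs_le_between in A1. apply Rabs_le_between in A2.
    assert (1 <= sqrt (Rabs (s - t))).
    { rewrite <- sqrt_1 at 1. apply sqrt_le_1_alt. lra. }
    apply Rabs_le. nra.
Qed.

(** In units of [32^-n], term [n] contributes at least [3/10], the earlier terms at most [1/31] and
    the later ones at most [3/32]. The last two together stay below [1/5], which leaves [1/10]. *)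
Lemma lacunary_separate s t n :
  lam * 1024 ^ n * Rabs (s - t) <= 1 ->
  Rabs (s - t) <= (/ 1024) ^ n ->
  3 / 10 <= Rabs (phi (lam * 1024 ^ n * s) - phi (lam * 1024 ^ n * t)) ->
  / 10 * (/ 32) ^ n <= Rabs (lacunary phi lam s - lacunary phi lam t).
Proof.
  intros H1 H2 H3. destruct (lacunary_diff s t) as [He ->].
  pose proof (lacunary_diff_head s t n H2) as A1.
  pose proof (lacunary_diff_tail s t (S n)) as A2. simpl in A2.
  assert (Hn : ex_series (fun k => diff s t (n + k)%nat)).
  { now apply (@ex_series_incr_n R_AbsRing R_NormedModule). }
  pose proof (Series_incr_1 _ Hn) as E. cbv beta in E. rewrite Nat.add_0_r in E.
  rewrite (Series_ext (fun k => diff s t (n + S k)%nat)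
    (fun k => diff s t (S (n + k))%nat)) in E.
  2:{ intros k. f_equal. lia. }
  assert (0 < (/ 32) ^ n) by (apply pow_lt; lra).
  assert (E1 : lam * Rabs (s - t) * 32 ^ n <= (/ 32) ^ n).
  { replace (32 ^ n) with (1024 ^ n * (/ 32) ^ n).
    2:{ rewrite <- Rpow_mult_distr. f_equal. lra. }
    nra. }
  assert (E2 : 3 / 10 * (/ 32) ^ n <= Rabs (diff s t n)).
  { unfold diff, term. rewrite <- Rmult_minus_distr_l, Rabs_mult.
    rewrite (Rabs_pos_eq (_ ^ _)) by lra. nra. }
  pose proof (Rabs_triang_inv (diff s t n) (diff s t n - Series (diff s t))) as A3.
  replace (diff s t n - (diff s t n - Series (diff s t))) with (Series (diff s t)) in A3 by ring.
  assert (Rabs (diff s t n - Series (diff s t)) <= / 5 * (/ 32) ^ n).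
  { apply Rabs_le_between in A1. apply Rabs_le_between in A2. apply Rabs_le. lra. }
  lra.
Qed.

End Lacunary.

(** Take the integer part of [/ y]. Consecutive scales differ by the factor 1024, so finitely many
    frequency factors bring the phase difference at every scale into the range of
    [cos_sin_separate]. *)
Lemma integer_rescale (y : R) : / 1024 < y <= 1 ->
  exists m, (m <= 1024)%nat /\ / 2 <= INR m * y <= 1.
Proof.
  intros Hy.
  destruct (nfloor_ex (/ y)) as (m & Hm1 & Hm2). { left. apply Rinv_0_lt_compat. lra. }
  assert (E : / y * y = 1) by (field; lra).
  assert (1 <= / y) by nra.
  assert (/ y < 1024) by nra.
  exists m. split.
  - apply INR_le. replace (INR 1024) with 1024 by (rewrite INR_IZR_INZ; reflexivity). lra.
  - assert (1 <= INR m).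
    { change 1 with (INR 1). apply le_INR. apply Nat.le_succ_l. apply INR_lt. simpl. lra. }
    split; [|nra]. destruct (Rle_lt_dec (/ 2) y); nra.
Qed.

(* For [|s - t|] of size [1024^-n] the [n]-th term of the lacunary series with a suitable
   frequency dominates: the later ones are small and the earlier ones vary little. *)
Lemma snowflake_line : exists (hs : list (R -> R)) (H : R), 0 < H /\
  (forall h, In h hs -> (forall t, Rabs (h t) <= 2) /\
     forall s t, Rabs (h s - h t) <= H * sqrt (Rabs (s - t))) /\
  forall s t, Rabs (s - t) <= 1 ->
    exists h, In h hs /\ / 10 * sqrt (Rabs (s - t)) <= Rabs (h s - h t).
Proof.
  pose (fam phi := map (fun m => lacunary phi (INR m)) (seq 0 1025)).
  assert (Hcos : forall t, Rabs (cos t) <= 1).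
  { intros t. apply Rabs_le. pose proof (COS_bound t). lra. }
  assert (Hsin : forall t, Rabs (sin t) <= 1).
  { intros t. apply Rabs_le. pose proof (SIN_bound t). lra. }
  assert (Hin : forall phi m, (m <= 1024)%nat -> In (lacunary phi (INR m)) (fam phi)).
  { intros phi m Hm. apply in_map with (f := fun m => lacunary phi (INR m)).
    apply in_seq. lia. }
  exists (fam cos ++ fam sin), (32 * (1024 + 3)).
  split; [lra|]. split.
  - intros h Hh.
    assert (exists phi m, h = lacunary phi (INR m) /\ (m <= 1024)%nat /\
      (forall t, Rabs (phi t) <= 1) /\
      forall s t, Rabs (phi s - phi t) <= Rabs (s - t)) as (phi & m & -> & Hm & H1 & H2).
    { apply in_app_or in Hh. destruct Hh as [Hh|Hh];
        apply in_map_iff in Hh; destruct Hh as (m & <- & Hm); apply in_seq in Hm.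
      - exists cos, m. repeat split; [lia|auto|apply cos_lipschitz].
      - exists sin, m. repeat split; [lia|auto|apply sin_lipschitz]. }
    pose proof (pos_INR m).
    split; [intros t; now apply lacunary_bounded|].
    intros s t. pose proof (lacunary_holder phi H1 H2 (INR m) H s t).
    assert (INR m <= 1024).
    { apply le_INR in Hm. replace (INR 1024) with 1024 in Hm
        by (rewrite INR_IZR_INZ; reflexivity). lra. }
    pose proof (sqrt_pos (Rabs (s - t))). nra.
  - intros s t Hst. pose proof (Rabs_pos (s - t)) as Hp.
    destruct (Req_dec (Rabs (s - t)) 0) as [H0|H0].
    (* Here [s = t], and any member of the family serves. *)
    { exists (lacunary cos (INR 0)). split.
      - apply in_or_app. left. apply Hin. lia.
      - rewrite H0, sqrt_0, Rmult_0_r. apply Rabs_pos. }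
    destruct (dyadic_scale (Rabs (s - t))) as (n & Hn1 & Hn2); [lra|].
    assert (Hpow : 0 < 1024 ^ n) by (apply pow_lt; lra).
    assert (Hinv : (/ 1024) ^ n * 1024 ^ n = 1).
    { rewrite <- Rpow_mult_distr. replace (/ 1024 * 1024) with 1 by lra. apply pow1. }
    destruct (integer_rescale (1024 ^ n * Rabs (s - t))) as (m & Hm & Hmy).
    { simpl in Hn1. nra. }
    assert (Hx : sqrt (Rabs (s - t)) <= (/ 32) ^ n).
    { rewrite <- (sqrt_pow2 ((/ 32) ^ n)) by (apply pow_le; lra).
      apply sqrt_le_1_alt. rewrite <- pow_mult, Nat.mul_comm, pow_mult.
      replace ((/ 32) ^ 2) with (/ 1024) by lra. lra. }
    pose proof (pos_INR m).
    rewrite <- Rmult_assoc in Hmy.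
    destruct (cos_sin_separate (INR m * 1024 ^ n * s) (INR m * 1024 ^ n * t)) as [Hs|Hs].
    { rewrite <- Rmult_minus_distr_l, Rabs_mult, (Rabs_pos_eq (INR m * _)) by nra. lra. }
    + exists (lacunary cos (INR m)). split; [apply in_or_app; left; now apply Hin|].
      eapply Rle_trans; [|apply lacunary_separate with (n := n); auto using cos_lipschitz; lra].
      lra.
    + exists (lacunary sin (INR m)). split; [apply in_or_app; right; now apply Hin|].
      eapply Rle_trans; [|apply lacunary_separate with (n := n); auto using sin_lipschitz; lra].
      lra.
Qed.

(** Rescaling by [M] reduces to [snowflake_line]; the single constant [H] serves both as bound and
    as Hölder constant. *)
Lemma snowflake_interval (M : R) : 0 < M ->
  exists (hs : list (R -> R)) (H c : R), 0 < H /\ 0 < c /\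
  (forall h, In h hs -> (forall t, Rabs (h t) <= H) /\
     forall s t, Rabs (h s - h t) <= H * sqrt (Rabs (s - t))) /\
  forall s t, Rabs (s - t) <= M ->
    exists h, In h hs /\ c * sqrt (Rabs (s - t)) <= Rabs (h s - h t).
Proof.
  intros HM. destruct snowflake_line as (hs & H & HH & Hh & Hs).
  assert (E : forall s t, Rabs (s / M - t / M) = / M * Rabs (s - t)).
  { intros s t. replace (s / M - t / M) with (/ M * (s - t)) by (field; lra).
    rewrite Rabs_mult, Rabs_pos_eq; [auto|]. left. now apply Rinv_0_lt_compat. }
  assert (HiM : 0 < / M) by now apply Rinv_0_lt_compat.
  assert (HsM : 0 < sqrt (/ M)) by now apply sqrt_lt_R0.
  exists (map (fun h t => h (t / M)) hs), (2 + H * sqrt (/ M)), (/ 10 * sqrt (/ M)).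
  split; [nra|]. split; [nra|]. split.
  - intros h' Hh'. apply in_map_iff in Hh'. destruct Hh' as (h & <- & Hin).
    destruct (Hh h Hin) as [H1 H2]. split.
    + intros t. specialize (H1 (t / M)). nra.
    + intros s t. specialize (H2 (s / M) (t / M)).
      rewrite E, sqrt_mult_alt in H2 by lra. pose proof (sqrt_pos (Rabs (s - t))). nra.
  - intros s t Hst. destruct (Hs (s / M) (t / M)) as (h & Hin & Hsep).
    { rewrite E. replace 1 with (/ M * M) by (field; lra). nra. }
    exists (fun t => h (t / M)). split.
    + now apply in_map with (f := fun h t => h (t / M)).
    + rewrite E, sqrt_mult_alt in Hsep by lra. lra.
Qed.

(** * The Heisenberg metric and its vertical planes *)

Lemma sqrt_le_of_le_sq (x y : R) : 0 <= y -> x <= y * y -> sqrt x <= y.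
Proof.
  intros Hy H. rewrite <- (sqrt_square y Hy). now apply sqrt_le_1_alt.
Qed.

(** The vertical coordinate of the product of the inverse of [w'] with [w] in the Heisenberg
    group. *)
Definition vert (w w' : pt) : R := pz w - pz w' + / 2 * (px w * py w' - px w' * py w).

(* [dH] satisfies the triangle inequality only up to a constant; replacing the sum by a
   maximum gives an equivalent genuine metric. *)
Definition dmax (w w' : pt) : R :=
  Rmax (Rabs (px w - px w') + Rabs (py w - py w')) (sqrt (Rabs (vert w w'))).

Lemma dmax_horizontal w w' : Rabs (px w - px w') + Rabs (py w - py w') <= dmax w w'.
Proof. apply Rmax_l. Qed.

Lemma dmax_nonneg w w' : 0 <= dmax w w'.
Proof. eapply Rle_trans; [apply sqrt_pos|apply Rmax_r]. Qed.

Lemma dmax_vertical w w' : Rabs (vert w w') <= dmax w w' * dmax w w'.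
Proof.
  rewrite <- (sqrt_sqrt (Rabs (vert w w'))) by apply Rabs_pos.
  pose proof (sqrt_pos (Rabs (vert w w'))).
  assert (sqrt (Rabs (vert w w')) <= dmax w w') by apply Rmax_r. nra.
Qed.

Lemma dmax_le_dH w w' : dmax w w' <= dH w w'.
Proof.
  unfold dH. fold (vert w w'). pose proof (sqrt_pos (Rabs (vert w w'))).
  pose proof (Rabs_pos (px w - px w')). pose proof (Rabs_pos (py w - py w')).
  apply Rmax_lub; lra.
Qed.

Lemma dH_le_dmax w w' : dH w w' <= 2 * dmax w w'.
Proof.
  unfold dH. fold (vert w w'). pose proof (dmax_horizontal w w').
  assert (sqrt (Rabs (vert w w')) <= dmax w w') by apply Rmax_r. lra.
Qed.

Lemma dmax_pseudometric : pseudometric dmax.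
Proof.
  constructor.
  - intros a. unfold dmax. replace (vert a a) with 0 by (unfold vert; ring).
    rewrite !Rminus_diag, Rabs_R0, sqrt_0, Rplus_0_r. apply Rmax_left. lra.
  - intros a b. unfold dmax. rewrite (Rabs_minus_sym (px a)), (Rabs_minus_sym (py a)).
    replace (vert a b) with (- vert b a) by (unfold vert; ring). now rewrite Rabs_Ropp.
  - intros a b c. pose proof (dmax_nonneg a b). pose proof (dmax_nonneg b c).
    pose proof (dmax_horizontal a b) as H1. pose proof (dmax_horizontal b c) as H2.
    pose proof (dmax_vertical a b) as V1. pose proof (dmax_vertical b c) as V2.
    apply Rmax_lub.
    + replace (px a - px c) with ((px a - px b) + (px b - px c)) by ring.
      replace (py a - py c) with ((py a - py b) + (py b - py c)) by ring.
      pose proof (Rabs_triang (px a - px b) (px b - px c)).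
      pose proof (Rabs_triang (py a - py b) (py b - py c)). lra.
    + apply sqrt_le_of_le_sq; [lra|].
      (* [vert] is additive up to half the cross product of the horizontal increments. That error is
         at most half of [dmax a b * dmax b c], within the mixed term of the squared sum. *)
      replace (vert a c) with (vert a b + vert b c
        + - / 2 * ((px a - px b) * (py b - py c))
        + / 2 * ((py a - py b) * (px b - px c))) by (unfold vert; field).
      eapply Rle_trans; [apply Rabs_triang|].
      eapply Rle_trans; [apply Rplus_le_compat_r, Rabs_triang|].
      eapply Rle_trans; [apply Rplus_le_compat_r, Rplus_le_compat_r, Rabs_triang|].
      rewrite !Rabs_mult, Rabs_Ropp, (Rabs_pos_eq (/ 2)) by lra.
      pose proof (Rabs_pos (px a - px b)). pose proof (Rabs_pos (px b - px c)).
      pose proof (Rabs_pos (py a - py b)). pose proof (Rabs_pos (py b - py c)).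
      set (p := Rabs (px a - px b)) in *. set (q := Rabs (px b - px c)) in *.
      set (r := Rabs (py a - py b)) in *. set (s := Rabs (py b - py c)) in *.
      assert ((p + r) * (q + s) <= dmax a b * dmax b c) by (apply Rmult_le_compat; lra).
      nra.
Qed.

(* Two points of a plane [al x + be y = ga] satisfy [vert w w' = l w - l w'] for an affine
   function [l], so there the metric is the product of a line and a snowflaked line. *)
Lemma embeddable_vertical_strip (al be ga M : R) : (al <> 0 \/ be <> 0) ->
  embeddable dmax (fun w => al * px w + be * py w = ga /\ Rabs (px w) <= M /\
    Rabs (py w) <= M /\ Rabs (pz w) <= M).
Proof.
  intros Hne.
  assert (Hn : 0 < al * al + be * be).
  { destruct Hne; nra. }
  (* The foot of the perpendicular from the origin to the line [al x + be y = ga]. *)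
  set (x0 := al * ga / (al * al + be * be)). set (y0 := be * ga / (al * al + be * be)).
  set (l w := pz w + / 2 * (px w * y0 - py w * x0)).
  set (A := fun w => al * px w + be * py w = ga /\ Rabs (px w) <= M /\
    Rabs (py w) <= M /\ Rabs (pz w) <= M).
  assert (Hl : forall w w', A w -> A w' -> vert w w' = l w - l w').
  { intros w w' [Hw _] [Hw' _]. unfold vert, l.
    assert (H0 : al * x0 + be * y0 = ga) by (unfold x0, y0; field; lra).
    (* Both displacements from the foot are orthogonal to [(al, be)], hence parallel to each
       other. *)
    assert (Hz : (px w - x0) * (py w' - y0) - (px w' - x0) * (py w - y0) = 0); [|lra].
    assert (E1 : al * (px w - x0) + be * (py w - y0) = 0) by lra.
    assert (E2 : al * (px w' - x0) + be * (py w' - y0) = 0) by lra.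
    set (p := px w - x0) in *. set (q := py w - y0) in *.
    set (p' := px w' - x0) in *. set (q' := py w' - y0) in *.
    assert (al * (p * q' - p' * q) = 0).
    { replace (al * (p * q' - p' * q)) with ((al * p + be * q) * q' - (al * p' + be * q') * q)
        by ring. rewrite E1, E2. ring. }
    assert (be * (p * q' - p' * q) = 0).
    { replace (be * (p * q' - p' * q)) with (p * (al * p' + be * q') - p' * (al * p + be * q))
        by ring. rewrite E1, E2. ring. }
    destruct Hne as [Hne|Hne]; [apply Rmult_integral in H|apply Rmult_integral in H1];
      tauto. }
  (* Bounds the oscillation of [l] on the strip, so that a snowflake embedding at distances up to
     [D] suffices; the final [1] keeps [D] positive. *)
  set (D := 2 * (Rabs M + / 2 * (Rabs M * Rabs y0 + Rabs M * Rabs x0)) + 1).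
  assert (HD : 0 < D).
  { unfold D. pose proof (Rabs_pos M). pose proof (Rabs_pos x0). pose proof (Rabs_pos y0). nra. }
  assert (HlD : forall w w', A w -> A w' -> Rabs (l w - l w') <= D).
  { assert (HB : forall w, A w -> Rabs (l w) <= (D - 1) / 2).
    { intros w (_ & H1 & H2 & H3). unfold l, D.
      pose proof (Rle_abs M). pose proof (Rabs_pos x0). pose proof (Rabs_pos y0).
      pose proof (Rabs_pos (px w)). pose proof (Rabs_pos (py w)).
      eapply Rle_trans; [apply Rabs_triang|].
      rewrite Rabs_mult, (Rabs_pos_eq (/ 2)) by lra.
      pose proof (Rabs_triang (px w * y0) (- (py w * x0))) as T.
      rewrite Rabs_Ropp, !Rabs_mult in T. unfold Rminus.
      assert (Rabs (px w) * Rabs y0 <= Rabs M * Rabs y0) by nra.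
      assert (Rabs (py w) * Rabs x0 <= Rabs M * Rabs x0) by nra. lra. }
    intros w w' Hw Hw'. pose proof (HB w Hw) as B1. pose proof (HB w' Hw') as B2.
    apply Rabs_le_between in B1. apply Rabs_le_between in B2. apply Rabs_le. lra. }
  destruct (snowflake_interval D HD) as (hs & H & c & HH & Hc & Hh & Hsep).
  apply embeddable_of_lipschitz_on with
    (fs := px :: py :: map (fun h w => h (l w)) hs) (c := Rmin (/ 2) c).
  - apply dmax_pseudometric.
  - apply Rmin_pos; lra.
  - intros f [<-|[<-|Hf]].
    + exists 1. split; [lra|]. intros a b _ _. pose proof (dmax_horizontal a b).
      pose proof (Rabs_pos (py a - py b)). lra.
    + exists 1. split; [lra|]. intros a b _ _. pose proof (dmax_horizontal a b).
      pose proof (Rabs_pos (px a - px b)). lra.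
    + apply in_map_iff in Hf. destruct Hf as (h & <- & Hin).
      exists H. split; [lra|]. intros a b Ha Hb.
      destruct (Hh h Hin) as [_ Hhol]. eapply Rle_trans; [apply Hhol|].
      apply Rmult_le_compat_l; [lra|]. rewrite <- (Hl a b Ha Hb). apply Rmax_r.
  - intros a b Ha Hb. pose proof (Rmin_l (/ 2) c). pose proof (Rmin_r (/ 2) c).
    pose proof (dmax_nonneg a b).
    assert (Hcase : dmax a b = Rabs (px a - px b) + Rabs (py a - py b) \/
      dmax a b = sqrt (Rabs (vert a b))).
    { unfold dmax. apply Rmax_case; auto. }
    destruct Hcase as [E|E].
    (* The larger of the two coordinate differences is at least half of their sum, whence the
       constant [/ 2]. *)
    + destruct (Rle_lt_dec (Rabs (px a - px b)) (Rabs (py a - py b))).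
      * exists py. split; [simpl; auto|nra].
      * exists px. split; [simpl; auto|nra].
    + destruct (Hsep (l a) (l b)) as (h & Hin & Hs); [now apply HlD|].
      exists (fun w => h (l w)). split.
      * right. right. now apply in_map with (f := fun h w => h (l w)).
      * rewrite <- (Hl a b Ha Hb), <- E in Hs. nra.
Qed.

(** * Non-vertical planes as cones over a snowflaked circle *)

(** With [r = |x| + |y|], the left side is [r * r'] times the difference of [x / r] and [x' / r'].
    If signs agree in each coordinate, it is the cross product in absolute value; across a sign
    change both entries are bounded by their difference, and the square absorbs what remains. *)
Lemma normalized_cross_le (x y x' y' : R) :
  Rabs (x * (Rabs x' + Rabs y') - x' * (Rabs x + Rabs y))
    <= Rabs (x * y' - x' * y) + 2 * (Rabs (x - x') + Rabs (y - y')) ^ 2.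
Proof.
  unfold Rabs; repeat destruct Rcase_abs; nra.
Qed.

(* Includes [r = 0], where [x = 0] and [x / r = 0]. *)
Lemma ratio_bound (x r : R) : Rabs x <= r -> x = r * (x / r) /\ Rabs (x / r) <= 1.
Proof.
  intros H. pose proof (Rabs_pos x).
  destruct (Req_dec r 0) as [->|Hr].
  - assert (x = 0) as -> by (apply Rabs_eq_0; lra).
    unfold Rdiv. rewrite !Rmult_0_l, Rabs_R0. lra.
  - split; [field; auto|]. unfold Rdiv. rewrite Rabs_mult, Rabs_inv, (Rabs_pos_eq r) by lra.
    apply Rmult_le_reg_r with r; [lra|]. rewrite Rmult_assoc, Rinv_l by auto. lra.
Qed.

(** The radial change is split off so that the smaller radius [r'] weights the angular part; then
    [r' * sqrt |u - u'| <= sqrt (r * r' * |u - u'|)], which is the last root. *)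
Lemma cone_upper (h : R -> R) (H x r x' r' : R) :
  (forall t, Rabs (h t) <= H) ->
  (forall s t, Rabs (h s - h t) <= H * sqrt (Rabs (s - t))) ->
  Rabs x <= r -> Rabs x' <= r' ->
  Rabs (r * h (x / r) - r' * h (x' / r'))
    <= H * Rabs (r - r') + H * sqrt (Rabs (x * r' - x' * r)).
Proof.
  intros Hb Hh. revert x r x' r'.
  assert (HH : 0 <= H) by (eapply Rle_trans; [apply Rabs_pos|apply (Hb 0)]).
  assert (W : forall x r x' r', Rabs x <= r -> Rabs x' <= r' -> r' <= r ->
    Rabs (r * h (x / r) - r' * h (x' / r'))
      <= H * Rabs (r - r') + H * sqrt (Rabs (x * r' - x' * r))).
  { intros x r x' r' Hx Hx' Hr.
    destruct (ratio_bound x r Hx) as [Ex _]. destruct (ratio_bound x' r' Hx') as [Ex' _].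
    set (u := x / r) in *. set (u' := x' / r') in *.
    replace (r * h u - r' * h u') with ((r - r') * h u + r' * (h u - h u')) by ring.
    pose proof (Rabs_pos x'). assert (0 <= r') by lra.
    eapply Rle_trans; [apply Rabs_triang|]. rewrite !Rabs_mult, (Rabs_pos_eq r') by lra.
    apply Rplus_le_compat.
    { specialize (Hb u). pose proof (Rabs_pos (r - r')). nra. }
    specialize (Hh u u').
    assert (r' * sqrt (Rabs (u - u')) <= sqrt (Rabs (x * r' - x' * r))); [|nra].
    rewrite <- (sqrt_square r') at 1 by lra. rewrite <- sqrt_mult_alt by nra.
    apply sqrt_le_1_alt. rewrite Ex, Ex'.
    replace (r * u * r' - r' * u' * r) with (r * r' * (u - u')) by ring.
    rewrite Rabs_mult, (Rabs_pos_eq (r * r')) by nra.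
    apply Rmult_le_compat_r; [apply Rabs_pos|nra]. }
  intros x r x' r' Hx Hx'. destruct (Rle_lt_dec r' r) as [Hr|Hr]; [auto|].
  rewrite (Rabs_minus_sym (r * _)), (Rabs_minus_sym r), (Rabs_minus_sym (x * r')).
  apply W; auto; lra.
Qed.

Lemma le_2_sqrt (m : R) : 0 <= m <= 2 -> m <= 2 * sqrt m.
Proof.
  intros Hm. rewrite <- (sqrt_sqrt m) at 1 by lra. pose proof (sqrt_pos m).
  assert (sqrt m <= 2) by (apply sqrt_le_of_le_sq; lra). nra.
Qed.

Lemma cone_lower (h : R -> R) (H c r u r' u' : R) :
  (forall t, Rabs (h t) <= H) -> 0 <= r' ->
  c * sqrt (Rabs (u - u')) <= Rabs (h u - h u') ->
  c * (r' * sqrt (Rabs (u - u'))) - H * Rabs (r - r') <= Rabs (r * h u - r' * h u').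
Proof.
  intros Hb Hr Hs. specialize (Hb u).
  replace (r * h u - r' * h u') with (r' * (h u - h u') - - ((r - r') * h u)) by ring.
  eapply Rle_trans; [|apply Rabs_triang_inv].
  rewrite Rabs_Ropp, !Rabs_mult, (Rabs_pos_eq r') by lra.
  pose proof (Rabs_pos (r - r')). pose proof (Rabs_pos (h u)). nra.
Qed.

Lemma cone_coordinate (r u r' u' m : R) :
  0 <= r' <= r -> Rabs u <= 1 -> Rabs (u - u') <= m -> 0 <= m <= 2 ->
  Rabs (r * u - r' * u') <= Rabs (r - r') + 2 * (r' * sqrt m).
Proof.
  intros Hr Hu Hm Hm2. pose proof (le_2_sqrt m Hm2).
  replace (r * u - r' * u') with ((r - r') * u + r' * (u - u')) by ring.
  eapply Rle_trans; [apply Rabs_triang|]. rewrite !Rabs_mult, (Rabs_pos_eq r') by lra.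
  pose proof (Rabs_pos (r - r')). nra.
Qed.

(** The cross product is [r * r'] times a number of size at most [m]. Writing
    [r * r' = (r - r') * r' + r' * r'] and using [m <= 2 * sqrt m] bounds it by the square of the
    right side. *)
Lemma cone_cross (r u v r' u' v' m : R) :
  0 <= r' <= r -> Rabs u + Rabs v <= 1 -> Rabs (u - u') <= m -> Rabs (v - v') <= m ->
  0 <= m <= 2 ->
  sqrt (Rabs (r * u * (r' * v') - r' * u' * (r * v))) <= Rabs (r - r') + r' * sqrt m.
Proof.
  intros Hr Huv Hu Hv Hm2. pose proof (le_2_sqrt m Hm2) as Hm.
  pose proof (Rabs_pos (r - r')). pose proof (sqrt_pos m).
  apply sqrt_le_of_le_sq; [nra|].
  replace (r * u * (r' * v') - r' * u' * (r * v))
    with (r * r' * (v * (u - u') - u * (v - v'))) by ring.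
  assert (Hrr : 0 <= r * r') by (apply Rmult_le_pos; lra).
  rewrite Rabs_mult, (Rabs_pos_eq (r * r')) by auto.
  assert (Rabs (v * (u - u') - u * (v - v')) <= m).
  { eapply Rle_trans; [apply Rabs_triang|]. rewrite Rabs_Ropp, !Rabs_mult.
    pose proof (Rabs_pos u). pose proof (Rabs_pos v). nra. }
  rewrite (Rabs_pos_eq (r - r')) in * by lra.
  assert (r * r' * Rabs (v * (u - u') - u * (v - v')) <= r * r' * m).
  { apply Rmult_le_compat_l; lra. }
  pose proof (sqrt_sqrt m (proj1 Hm2)) as E.
  assert (0 <= (r - r') * r') by (apply Rmult_le_pos; lra).
  assert ((r - r') * r' * m <= (r - r') * r' * (2 * sqrt m))
    by (apply Rmult_le_compat_l; lra).
  assert (0 <= (r - r') * (r - r')) by (apply Rmult_le_pos; lra).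
  replace (r * r' * m) with ((r - r') * r' * m + r' * r' * (sqrt m * sqrt m)) in *
    by (rewrite E; ring).
  lra.
Qed.

(* Left translation moves the plane to [z = 0], where the metric is that of the cone over
   the snowflaked circle [{|u| + |v| = 1}]: [r |u - u'|^(1/2)] in the angular direction. *)
Lemma embeddable_nonvertical_plane (al be ga : R) :
  embeddable dmax (fun w => pz w = al * px w + be * py w + ga).
Proof.
  destruct (snowflake_interval 2) as (hs & H & c & HH & Hc & Hh & Hsep); [lra|].
  (* The plane is tangent to the horizontal distribution at its point over [(2 * be, - 2 * al)];
     relative to that point [vert] becomes half the plain cross product. *)
  set (x w := px w - 2 * be). set (y w := py w + 2 * al).
  set (r w := Rabs (x w) + Rabs (y w)).
  set (A := fun w => pz w = al * px w + be * py w + ga).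
  assert (Hvert : forall a b, A a -> A b -> vert a b = / 2 * (x a * y b - x b * y a)).
  { intros a b Ha Hb. unfold vert, x, y. rewrite Ha, Hb. field. }
  assert (Hd : forall a b, Rabs (x a - x b) + Rabs (y a - y b) <= dmax a b).
  { intros a b. unfold x, y.
    replace (px a - 2 * be - (px b - 2 * be)) with (px a - px b) by ring.
    replace (py a + 2 * al - (py b + 2 * al)) with (py a - py b) by ring.
    apply dmax_horizontal. }
  assert (Hxr : forall w, Rabs (x w) <= r w).
  { intros w. unfold r. pose proof (Rabs_pos (y w)). lra. }
  assert (Hyr : forall w, Rabs (y w) <= r w).
  { intros w. unfold r. pose proof (Rabs_pos (x w)). lra. }
  assert (Hr0 : forall w, 0 <= r w).
  { intros w. eapply Rle_trans; [apply Rabs_pos|apply Hxr]. }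
  assert (Hr : forall a b, Rabs (r a - r b) <= dmax a b).
  { intros a b. specialize (Hd a b). unfold r.
    pose proof (Rabs_triang_inv2 (x a) (x b)) as T1. apply Rabs_le_between in T1.
    pose proof (Rabs_triang_inv2 (y a) (y b)) as T2. apply Rabs_le_between in T2.
    apply Rabs_le. lra. }
  assert (Hcross : forall a b, A a -> A b ->
    Rabs (x a * y b - x b * y a) <= 2 * (dmax a b * dmax a b)).
  { intros a b Ha Hb. pose proof (dmax_vertical a b) as V. rewrite (Hvert a b Ha Hb) in V.
    rewrite Rabs_mult, Rabs_pos_eq in V by lra. lra. }
  assert (Hupper : forall a b, A a -> A b ->
    Rabs (x a * r b - x b * r a) <= (2 * dmax a b) * (2 * dmax a b) /\
    Rabs (y a * r b - y b * r a) <= (2 * dmax a b) * (2 * dmax a b)).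
  { intros a b Ha Hb. specialize (Hcross a b Ha Hb). specialize (Hd a b).
    assert ((Rabs (x a - x b) + Rabs (y a - y b)) ^ 2 <= dmax a b * dmax a b).
    { pose proof (Rabs_pos (x a - x b)). pose proof (Rabs_pos (y a - y b)). simpl.
      rewrite Rmult_1_r. apply Rmult_le_compat; lra. }
    split.
    - pose proof (normalized_cross_le (x a) (y a) (x b) (y b)). unfold r. lra.
    - pose proof (normalized_cross_le (y a) (x a) (y b) (x b)) as N.
      rewrite (Rplus_comm (Rabs (y b))), (Rplus_comm (Rabs (y a))),
        (Rplus_comm (Rabs (y a - y b))), Rabs_minus_sym with (x := y a * x b) in N.
      rewrite (Rmult_comm (y b) (x a)), (Rmult_comm (y a) (x b)) in N. unfold r. lra. }
  (* Chosen so that [(c / 2 + H) * eps = c / 8]: when [r] does not separate, the radial losses take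
     at most half of the [c / 4 * dmax a b] given by the angular part. *)
  set (eps := c / (4 * c + 8 * H)).
  assert (Heps : 0 < eps) by (apply Rdiv_lt_0_compat; lra).
  assert (Heps' : eps * (4 * c + 8 * H) = c) by (unfold eps; field; lra).
  set (fs := r :: map (fun h w => r w * h (x w / r w)) hs
               ++ map (fun h w => r w * h (y w / r w)) hs).
  assert (Hlower : forall a b, A a -> A b -> r b <= r a -> exists f, In f fs /\
    Rmin eps (c / 8) * dmax a b <= Rabs (f a - f b)).
  { intros a b Ha Hb Hab.
    pose proof (Rmin_l eps (c / 8)). pose proof (Rmin_r eps (c / 8)).
    pose proof (dmax_nonneg a b) as Hd0.
    destruct (Rle_lt_dec (eps * dmax a b) (Rabs (r a - r b))) as [Hfar|Hnear].
    { exists r. split; [now left|nra]. }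
    destruct (ratio_bound _ _ (Hxr a)) as [Exa Uxa].
    destruct (ratio_bound _ _ (Hxr b)) as [Exb Uxb].
    destruct (ratio_bound _ _ (Hyr a)) as [Eya Uya].
    destruct (ratio_bound _ _ (Hyr b)) as [Eyb Uyb].
    assert (Huv : Rabs (x a / r a) + Rabs (y a / r a) <= 1).
    { destruct (Req_dec (r a) 0) as [E|E].
      - rewrite E. unfold Rdiv. rewrite Rinv_0, !Rmult_0_r, Rabs_R0. lra.
      - unfold Rdiv. rewrite !Rabs_mult, <- Rmult_plus_distr_r. fold (r a).
        rewrite Rabs_inv, Rabs_pos_eq by auto. rewrite Rinv_r by auto. lra. }
    pose proof (Hr0 b) as Hrb.
    set (u := x a / r a) in *. set (u' := x b / r b) in *.
    set (v := y a / r a) in *. set (v' := y b / r b) in *.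
    (* The angular distance; the coordinate that attains it supplies the separating function. *)
    set (m := Rmax (Rabs (u - u')) (Rabs (v - v'))).
    assert (Hmu : Rabs (u - u') <= m) by apply Rmax_l.
    assert (Hmv : Rabs (v - v') <= m) by apply Rmax_r.
    assert (Hu2 : Rabs (u - u') <= 2).
    { apply Rabs_le_between in Uxa. apply Rabs_le_between in Uxb. apply Rabs_le. lra. }
    assert (Hv2 : Rabs (v - v') <= 2).
    { apply Rabs_le_between in Uya. apply Rabs_le_between in Uyb. apply Rabs_le. lra. }
    assert (Hm : 0 <= m <= 2).
    { split; [eapply Rle_trans; [apply Rabs_pos|apply Hmu]|now apply Rmax_lub]. }
    assert (Hrab : 0 <= r b <= r a) by lra.
    assert (Hdm : dmax a b <= 2 * Rabs (r a - r b) + 4 * (r b * sqrt m)).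
    { pose proof (sqrt_pos m). pose proof (Rabs_pos (r a - r b)). apply Rmax_lub.
      - replace (px a - px b) with (x a - x b) by (unfold x; ring).
        replace (py a - py b) with (y a - y b) by (unfold y; ring).
        rewrite Exa, Exb, Eya, Eyb.
        pose proof (cone_coordinate _ _ _ _ m Hrab Uxa Hmu Hm).
        pose proof (cone_coordinate _ _ _ _ m Hrab Uya Hmv Hm). lra.
      - pose proof (cone_cross _ _ _ _ _ _ m Hrab Huv Hmu Hmv Hm) as K.
        rewrite <- Exa, <- Exb, <- Eya, <- Eyb in K.
        rewrite (Hvert a b Ha Hb), Rabs_mult, (Rabs_pos_eq (/ 2)) by lra.
        assert (sqrt (/ 2 * Rabs (x a * y b - x b * y a))
          <= sqrt (Rabs (x a * y b - x b * y a))).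
        { apply sqrt_le_1_alt. pose proof (Rabs_pos (x a * y b - x b * y a)). lra. }
        nra. }
    assert (Hend : c / 8 * dmax a b <= c * (r b * sqrt m) - H * Rabs (r a - r b)).
    { assert (c * dmax a b <= c * (2 * Rabs (r a - r b) + 4 * (r b * sqrt m)))
        by (apply Rmult_le_compat_l; lra).
      assert ((c / 2 + H) * Rabs (r a - r b) <= (c / 2 + H) * (eps * dmax a b))
        by (apply Rmult_le_compat_l; lra).
      replace ((c / 2 + H) * (eps * dmax a b)) with (eps * (4 * c + 8 * H) / 8 * dmax a b) in H3
        by field.
      rewrite Heps' in H3. lra. }
    assert (Hcase : m = Rabs (u - u') \/ m = Rabs (v - v')).
    { unfold m. apply Rmax_case; auto. }
    destruct Hcase as [E|E].
    - destruct (Hsep u u' Hu2) as (h & Hin & Hs). destruct (Hh h Hin) as [Hb1 _].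
      exists (fun w => r w * h (x w / r w)). split.
      + right. apply in_or_app. left. now apply in_map with (f := fun h w => r w * h (x w / r w)).
      + pose proof (cone_lower h H c (r a) u (r b) u' Hb1 Hrb Hs).
        rewrite <- E in H2. fold u u'. nra.
    - destruct (Hsep v v' Hv2) as (h & Hin & Hs). destruct (Hh h Hin) as [Hb1 _].
      exists (fun w => r w * h (y w / r w)). split.
      + right. apply in_or_app. right. now apply in_map with (f := fun h w => r w * h (y w / r w)).
      + pose proof (cone_lower h H c (r a) v (r b) v' Hb1 Hrb Hs).
        rewrite <- E in H2. fold v v'. nra. }
  apply embeddable_of_lipschitz_on with (fs := fs) (c := Rmin eps (c / 8)).
  - apply dmax_pseudometric.
  - apply Rmin_pos; lra.
  - assert (Hcone : forall h p, In h hs -> (forall w, Rabs (p w) <= r w) ->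
      (forall a b, A a -> A b -> Rabs (p a * r b - p b * r a) <= (2 * dmax a b) * (2 * dmax a b)) ->
      exists L, 0 <= L /\ lipschitz_on dmax A L (fun w => r w * h (p w / r w))).
    { intros h p Hin Hp Hpc. exists (3 * H). split; [lra|]. intros a b Ha Hb.
      destruct (Hh h Hin) as [Hb1 Hb2].
      pose proof (cone_upper h H _ _ _ _ Hb1 Hb2 (Hp a) (Hp b)).
      specialize (Hr a b). pose proof (dmax_nonneg a b).
      assert (sqrt (Rabs (p a * r b - p b * r a)) <= 2 * dmax a b)
        by (apply sqrt_le_of_le_sq; [lra|auto]).
      nra. }
    intros f [<-|Hf].
    + exists 1. split; [lra|]. intros a b _ _. rewrite Rmult_1_l. apply Hr.
    + apply in_app_or in Hf. destruct Hf as [Hf|Hf]; apply in_map_iff in Hf;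
        destruct Hf as (h & <- & Hin); apply Hcone; auto; intros; now apply Hupper.
  - intros a b Ha Hb. destruct (Rle_lt_dec (r b) (r a)) as [Hab|Hab]; [auto|].
    destruct (Hlower b a Hb Ha) as (f & Hf & Hfc); [lra|].
    exists f. split; [auto|]. rewrite Rabs_minus_sym.
    rewrite (pseudo_sym dmax dmax_pseudometric). auto.
Qed.

(** * Simplices and their finite unions *)

Lemma hull_halfspace (al be ka ga : R) (vs : list pt) (w : pt) :
  (forall v, In v vs -> al * px v + be * py v + ka * pz v <= ga) ->
  hull vs w -> al * px w + be * py w + ka * pz w <= ga.
Proof.
  intros Hv (lam & Hlen & Hpos & Hsum & ->).
  (* The total weight is left general, because dropping a vertex destroys [sumR lam = 1]. *)
  enough (E : al * px (lincomb lam vs) + be * py (lincomb lam vs)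
    + ka * pz (lincomb lam vs) <= sumR lam * ga) by (rewrite Hsum in E; lra).
  clear Hsum. revert lam Hlen Hpos.
  induction vs as [|v vs IH]; intros [|l lam] Hlen Hpos; simpl in *; try lia; try lra.
  apply Forall_cons_iff in Hpos. destruct Hpos as [Hl Hpos].
  specialize (IH (fun v Hin => Hv v (or_intror Hin)) lam (eq_add_S _ _ Hlen) Hpos).
  specialize (Hv v (or_introl eq_refl)).
  assert (l * (al * px v + be * py v + ka * pz v) <= l * ga)
    by (apply Rmult_le_compat_l; lra).
  lra.
Qed.

Lemma hull_plane (al be ka ga : R) (vs : list pt) (w : pt) :
  (forall v, In v vs -> al * px v + be * py v + ka * pz v = ga) ->
  hull vs w -> al * px w + be * py w + ka * pz w = ga.
Proof.
  intros Hv Hw. apply Rle_antisym.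
  - apply hull_halfspace with vs; auto. intros v Hin. rewrite (Hv v Hin). lra.
  - pose proof (hull_halfspace (- al) (- be) (- ka) (- ga) vs w) as K.
    assert (- al * px w + - be * py w + - ka * pz w <= - ga); [|lra].
    apply K; auto. intros v Hin. rewrite <- (Hv v Hin). lra.
Qed.

Lemma hull_bounded (vs : list pt) :
  exists M, forall w, hull vs w -> Rabs (px w) <= M /\ Rabs (py w) <= M /\ Rabs (pz w) <= M.
Proof.
  assert (H : exists M, forall v, In v vs ->
    Rabs (px v) <= M /\ Rabs (py v) <= M /\ Rabs (pz v) <= M).
  { induction vs as [|v vs [M HM]].
    - exists 0. intros v [].
    - set (M' := Rmax M (Rabs (px v) + Rabs (py v) + Rabs (pz v))). exists M'.
      assert (M <= M') by apply Rmax_l.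
      assert (Rabs (px v) + Rabs (py v) + Rabs (pz v) <= M') by apply Rmax_r.
      pose proof (Rabs_pos (px v)). pose proof (Rabs_pos (py v)). pose proof (Rabs_pos (pz v)).
      intros v' [<-|Hin]; [lra|]. destruct (HM v' Hin) as (? & ? & ?). lra. }
  destruct H as [M HM]. exists M. intros w Hw.
  assert (HB : forall al be ka,
    (forall v, In v vs -> Rabs (al * px v + be * py v + ka * pz v) <= M) ->
    Rabs (al * px w + be * py w + ka * pz w) <= M).
  { intros al be ka H.
    assert (al * px w + be * py w + ka * pz w <= M).
    { apply hull_halfspace with vs; auto. intros v Hin. specialize (H v Hin).
      apply Rabs_le_between in H. lra. }
    assert (- al * px w + - be * py w + - ka * pz w <= M).
    { apply hull_halfspace with vs; auto. intros v Hin. specialize (H v Hin).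
      apply Rabs_le_between in H. lra. }
    apply Rabs_le. lra. }
  split; [|split].
  - replace (px w) with (1 * px w + 0 * py w + 0 * pz w) by ring. apply HB. intros v Hin.
    replace (1 * px v + 0 * py v + 0 * pz v) with (px v) by ring. now apply HM.
  - replace (py w) with (0 * px w + 1 * py w + 0 * pz w) by ring. apply HB. intros v Hin.
    replace (0 * px v + 1 * py v + 0 * pz v) with (py v) by ring. now apply HM.
  - replace (pz w) with (0 * px w + 0 * py w + 1 * pz w) by ring. apply HB. intros v Hin.
    replace (0 * px v + 0 * py v + 1 * pz v) with (pz v) by ring. now apply HM.
Qed.

(** Points and segments are put into vertical planes; for a triangle the normal is the cross product
    of two edges, nonzero by non-collinearity. *)
Lemma simplex_in_plane (vs : list pt) : is_simplex vs ->
  exists al be ka ga, (al <> 0 \/ be <> 0 \/ ka <> 0) /\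
    forall v, In v vs -> al * px v + be * py v + ka * pz v = ga.
Proof.
  destruct vs as [|a [|b [|c [|]]]]; simpl; try tauto.
  - intros _. exists 1, 0, 0, (px a). split; [left; lra|]. intros v [<-|[]]. ring.
  - intros _. destruct (Req_dec (px a) (px b)) as [E|E].
    + exists 1, 0, 0, (px a). split; [left; lra|]. intros v [<-|[<-|[]]]; [ring|lra].
    + exists (py b - py a), (px a - px b), 0, ((py b - py a) * px a + (px a - px b) * py a).
      split; [right; left; lra|]. intros v [<-|[<-|[]]]; ring.
  - unfold noncollinear. intros Hn.
    exists ((py b - py a) * (pz c - pz a) - (pz b - pz a) * (py c - py a)),
      ((pz b - pz a) * (px c - px a) - (px b - px a) * (pz c - pz a)),
      ((px b - px a) * (py c - py a) - (py b - py a) * (px c - px a)),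
      (((py b - py a) * (pz c - pz a) - (pz b - pz a) * (py c - py a)) * px a +
       ((pz b - pz a) * (px c - px a) - (px b - px a) * (pz c - pz a)) * py a +
       ((px b - px a) * (py c - py a) - (py b - py a) * (px c - px a)) * pz a).
    split; [tauto|]. intros v [<-|[<-|[<-|[]]]]; ring.
Qed.

(** A vertical plane ([ka = 0]) is handled on a bounded part, which contains the simplex by
    [hull_bounded]; otherwise the equation is solved for [z]. *)
Lemma embeddable_simplex (vs : list pt) : is_simplex vs -> embeddable dmax (hull vs).
Proof.
  intros Hs. destruct (simplex_in_plane vs Hs) as (al & be & ka & ga & Hne & Hp).
  destruct (Req_dec ka 0) as [->|Hka].
  - destruct (hull_bounded vs) as [M HM].
    eapply embeddable_subset; [|apply (embeddable_vertical_strip al be ga M); tauto].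
    intros w Hw. split; [|now apply HM].
    pose proof (hull_plane _ _ _ _ vs w Hp Hw). lra.
  - eapply embeddable_subset;
      [|apply (embeddable_nonvertical_plane (- al / ka) (- be / ka) (ga / ka))].
    intros w Hw. cbv beta. rewrite <- (hull_plane _ _ _ _ vs w Hp Hw). field. auto.
Qed.

Lemma embeddable_simplices (Ss : list (list pt)) : Forall is_simplex Ss ->
  embeddable dmax (fun w => exists S, In S Ss /\ hull S w).
Proof.
  induction 1 as [|S Ss HS _ IH].
  - exists nil, 1. split; [lra|]. split; [intros f []|]. intros a b (S & [] & _).
  - eapply embeddable_subset;
      [|apply (embeddable_union dmax _ _ dmax_pseudometric (embeddable_simplex S HS) IH)].
    intros w (T & [<-|HT] & Hw); eauto.
Qed.

(** * From separating functions to a Euclidean embedding *)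

Lemma Rabs_coordinate_le_euclid (N i : nat) (u v : nat -> R) : (i < N)%nat ->
  Rabs (u i - v i) <= euclid N u v.
Proof.
  intros Hi. unfold euclid. rewrite <- sqrt_Rsqr_abs. apply sqrt_le_1_alt.
  unfold Rsqr. induction N as [|N IH]; [lia|]. cbn [sumsq].
  assert (Hs : forall n, 0 <= sumsq n u v).
  { induction n as [|n IHn]; cbn [sumsq]; [lra|]. pose proof (pow2_ge_0 (u n - v n)). lra. }
  pose proof (pow2_ge_0 (u N - v N)).
  destruct (Nat.eq_dec i N) as [->|]; [specialize (Hs N); nra|].
  assert (Hi' : (i < N)%nat) by lia. specialize (IH Hi'). nra.
Qed.

Lemma euclid_le_of_coordinates (N : nat) (u v : nat -> R) (B : R) : 0 <= B ->
  (forall i, (i < N)%nat -> Rabs (u i - v i) <= B) -> euclid N u v <= INR N * B.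
Proof.
  intros HB H. unfold euclid. pose proof (pos_INR N).
  apply sqrt_le_of_le_sq; [now apply Rmult_le_pos|].
  induction N as [|N IH]; [simpl; lra|].
  pose proof (pos_INR N). rewrite S_INR. cbn [sumsq].
  specialize (IH (fun i Hi => H i (Nat.lt_lt_succ_r _ _ Hi)) H1).
  specialize (H N (Nat.lt_succ_diag_r N)).
  assert ((u N - v N) ^ 2 <= B * B).
  { rewrite <- (pow2_abs). simpl. rewrite Rmult_1_r. pose proof (Rabs_pos (u N - v N)).
    apply Rmult_le_compat; lra. }
  assert (0 <= INR N * (B * B)) by (apply Rmult_le_pos; nra). nra.
Qed.

Theorem theorem3p5 :
  forall Ds : list (list (list pt)),
    Forall is_complex Ds ->
    exists (N : nat) (f : pt -> (nat -> R)) (L : R),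
      1 <= L /\
      forall a b, union_set Ds a -> union_set Ds b ->
        / L * dH a b <= euclid N (f a) (f b) /\
        euclid N (f a) (f b) <= L * dH a b.
Proof.
  intros Ds HDs.
  assert (HS : Forall is_simplex (concat Ds)).
  { apply Forall_concat. eapply Forall_impl; [|exact HDs]. intros D HD. apply HD. }
  destruct (embeddable_simplices _ HS) as (fs & c & Hc & Hfl & Hfs).
  destruct (lipschitz_common_constant _ fs dmax_pseudometric Hfl) as (L & HL & HfL).
  (* The summands of the constant ensure in turn [1 <= L], the upper bound by adding up coordinates,
     and the lower bound, where the 2 comes from [dH_le_dmax]. *)
  exists (length fs), (fun w i => nth i fs (fun _ => 0) w),
    (1 + INR (length fs) * L + 2 / c).
  pose proof (pos_INR (length fs)) as Hn.
  assert (HnL : 0 <= INR (length fs) * L) by now apply Rmult_le_pos.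
  assert (Hc2 : 0 < 2 / c) by (apply Rdiv_lt_0_compat; lra).
  split; [lra|]. intros a b Ha Hb.
  assert (HK : forall w, union_set Ds w -> exists S, In S (concat Ds) /\ hull S w).
  { intros w (D & HD & S & HSD & Hw). exists S. split; [|auto].
    apply in_concat. eauto. }
  pose proof (dmax_nonneg a b) as Hd0.
  pose proof (dmax_le_dH a b). pose proof (dH_le_dmax a b).
  split.
  - destruct (Hfs a b (HK a Ha) (HK b Hb)) as (f & Hf & Hsep).
    destruct (In_nth _ _ (fun _ => 0) Hf) as (i & Hi & Hfi).
    pose proof (Rabs_coordinate_le_euclid _ _ (fun i => nth i fs (fun _ => 0) a)
      (fun i => nth i fs (fun _ => 0) b) Hi) as He. cbv beta in He. rewrite Hfi in He.
    apply Rle_trans with (c * dmax a b); [|lra].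
    apply Rle_trans with (/ (2 / c) * dH a b).
    + apply Rmult_le_compat_r; [lra|]. apply Rinv_le_contravar; lra.
    + replace (/ (2 / c)) with (c / 2) by (field; lra). nra.
  - apply Rle_trans with (INR (length fs) * (L * dmax a b)).
    + apply euclid_le_of_coordinates; [now apply Rmult_le_pos|].
      intros i Hi. apply HfL; [now apply nth_In|exact I|exact I].
    + nra.
Qed.
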